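(* Let $G$ be a simple graph. Let $k_3$ be the number of subsets of $V(G)$ of cardinality three that induce a connected subgraph of $G$. Let $S_{3,2}$ be the number of connected subgraphs of $G$ with order three and size two, and let $S_{3,3}$ be the number of connected subgraphs of $G$ with order three and size three. Then $$k_3 = S_{3,2}-2S_{3,3}.$$
   Context: Graphs are finite and simple. The order of a graph is its number of vertices and the size is its number of edges. Subgraphs counted by $S_{3,2}$ and $S_{3,3}$ are not required to be induced; a subgraph is determined by its vertex set and edge set. *)

(* Defs.v *)
From mathcomp Require Import all_boot.
Set Implicit Arguments.
Unset Strict Implicit.
Unset Printing Implicit Defensive.

Record sgraph := SGraph {
  vertex :> finType;
  adj : rel vertex;
  adj_sym : symmetric adj;
  adj_irrefl : irreflexive adj
}.

Section Subgraphs.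
Variable G : sgraph.

Definition edges : {set {set G}} :=
  [set [set p.1; p.2] | p : G * G & adj p.1 p.2].

(* A candidate subgraph is a pair (vertex set, edge set). *)
Local Notation pregraph := ({set G} * {set {set G}})%type.

Definition graph_order (H : pregraph) : nat := #|H.1|.
Definition graph_size (H : pregraph) : nat := #|H.2|.

Definition subgraph (H : pregraph) : bool :=
  (H.2 \subset edges) && [forall f in H.2, f \subset H.1].

Definition induced (W : {set G}) : pregraph :=
  (W, [set f in edges | f \subset W]).

(* The walks range over all of G, but when H is a subgraph every edge of H
   lies inside H.1, so walks starting in H.1 stay in H.1. *)
Definition connected (H : pregraph) : bool :=
  (H.1 != set0) &&
  [forall x in H.1, forall y in H.1,
    connect [rel u v | [set u; v] \in H.2] x y].

Definition num_connected_sets (k : nat) : nat :=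
  #|[set W : {set G} | (#|W| == k) && connected (induced W)]|.

Definition num_connected_subgraphs (n m : nat) : nat :=
  #|[set H : pregraph |
      [&& subgraph H, connected H, graph_order H == n & graph_size H == m]]|.

End Subgraphs.

(* Main.v *)
Require Import Defs.
From mathcomp Require Import all_boot all_order all_algebra.
From mathcomp Require Import zify.
Set Implicit Arguments.
Unset Strict Implicit.
Unset Printing Implicit Defensive.
Import GRing.Theory.
Local Open Scope ring_scope.

(** A subgraph on three vertices is connected iff it has at least two edges.
    Hence a vertex set W of order three that induces e <= 3 edges contributes
    [e >= 2] to k_3, C(e, 2) to S_{3,2} and C(e, 3) to S_{3,3}, and
    [e >= 2] + 2 C(e, 3) = C(e, 2). *)

Lemma subset_card3_card2 (T : finType) (W f : {set T}) :
  #|W| = 3%N -> f \subset W -> #|f| = 2%N -> exists2 u, u \in W & f = W :\ u.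
Proof.
move=> W3 fW f2; have /cards1P [u Wu] : #|W :\: f| == 1%N.
  by rewrite cardsD (setIidPr fW) W3 f2.
exists u; first by have := set11 u; rewrite -Wu inE => /andP[].
by rewrite -Wu setDDr setDv set0U (setIidPr fW).
Qed.

Section Subgraphs.
Variable G : sgraph.
Implicit Types (W : {set G}) (F : {set {set G}}).

Lemma card_edge (f : {set G}) : f \in edges G -> #|f| = 2%N.
Proof.
case/imsetP=> -[x y]; rewrite inE /= => xy ->; rewrite cards2.
by case: eqP xy => // ->; rewrite adj_irrefl.
Qed.

Lemma subgraphE (H : {set G} * {set {set G}}) :
  subgraph H = (H.2 \subset (induced H.1).2).
Proof.
apply/andP/subsetP => [[/subsetP sE /forall_inP sW] f fH|sH].
  by rewrite inE sE ?sW.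
split; first by apply/subsetP => f /sH; rewrite inE => /andP[].
by apply/forall_inP => f /sH; rewrite inE => /andP[].
Qed.

(** Naming an edge by the one vertex of [W] that it misses gives both the bound of three edges and
    the three-way case split on edges used for connectedness. *)
Lemma induced_edges_card3 W (f : {set G}) : #|W| = 3%N ->
  f \in (induced W).2 -> exists2 u, u \in W & f = W :\ u.
Proof.
by move=> W3; rewrite inE => /andP[/card_edge f2 fW]; apply: subset_card3_card2.
Qed.

Lemma induced_size_le3 W : #|W| = 3%N -> (#|(induced W).2| <= 3)%N.
Proof.
move=> W3; rewrite -W3; apply: leq_trans (leq_imset_card (fun u => W :\ u) W).
apply/subset_leq_card/subsetP => f /(induced_edges_card3 W3) [u uW ->].
exact: imset_f.
Qed.

(** Connectedness puts every vertex of [W] on some edge of [F]. If [F] had at most one edge, that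
    edge would contain all three vertices, yet an edge has only two. *)
Lemma connected_card3_size W F : #|W| = 3%N ->
  F \subset (induced W).2 -> connected (W, F) -> (2 <= #|F|)%N.
Proof.
move=> W3 /subsetP sF /andP[_ /= /forall_inP cF]; rewrite ltnNge; apply/negP.
move=> /card_le1_eqP F1.
(* The covering edge is the first step of a walk from [x] to another vertex of [W]. *)
have cover x : x \in W -> exists2 f, f \in F & x \in f.
  move=> xW; have /card_gt0P [y] : (0 < #|W :\ x|)%N.
    by have := cardsD1 x W; rewrite xW W3; case: #|_|.
  rewrite !inE => /andP[yx yW].
  have /connectP [[|z p] /= xp Dy] := forall_inP (cF x xW) y yW.
    by rewrite Dy eqxx in yx.
  by case/andP: xp => xz _; exists [set x; z]; rewrite // !inE eqxx.
have /card_gt0P [x /cover [f fF _]] : (0 < #|W|)%N by rewrite W3.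
have : (#|W| <= #|f|)%N.
  apply/subset_leq_card/subsetP => y /cover [g gF yg].
  by rewrite (F1 _ _ gF fF).
by have := sF f fF; rewrite inE => /andP[/card_edge -> _]; rewrite W3.
Qed.

(** If [x] and [y] are not joined by an edge of [F], only the two edges through the third vertex [z]
    remain possible. Having at least two edges, [F] contains both, and [x], [z], [y] is a walk. *)
Lemma size_connected_card3 W F : #|W| = 3%N ->
  F \subset (induced W).2 -> (2 <= #|F|)%N -> connected (W, F).
Proof.
move=> W3 /subsetP sF F2; rewrite /connected /= -card_gt0 W3 /=.
apply/forall_inP => x xW; apply/forall_inP => y yW.
have [->|xy] := eqVneq x y; first exact: connect0.
have [xyF|xyF] := boolP ([set x; y] \in F); first exact: connect1.
have /cards1P [z Dz] : #|W :\: [set x; y]| == 1%N.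
  have xyW : [set x; y] \subset W by rewrite subUset !sub1set xW.
  by rewrite cardsD (setIidPr xyW) W3 cards2 xy.
have WE v : (v \in W) = [|| v == x, v == y | v == z].
  have := congr1 (fun A : {set G} => v \in A) Dz; rewrite !inE.
  by case: eqP => [->|] //=; case: eqP => [->|] //=.
have : z \in W :\: [set x; y] by rewrite Dz set11.
rewrite !inE negb_or => /andP[/andP[zx zy] zW].
have DF : F = [set [set x; z]; [set z; y]].
  (* The pair on the right has at most two elements, so inclusion of [F] in it suffices. An edge of
     [F] missing [x] or [y] is in the pair; one missing [z] would be the excluded edge from [x] to
     [y]. *)
  apply/eqP; rewrite eqEcard cards2; apply/andP; split; last first.
    by apply: leq_trans F2; case: (_ != _).
  apply/subsetP => f fF.
  have [u] := induced_edges_card3 W3 (sF f fF).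
  rewrite WE !inE => /or3P[]/eqP-> Df; apply/orP.
  - right; apply/eqP/setP => v; rewrite Df !inE WE.
    by case: (eqVneq v x) => [->|_] /=;
       rewrite ?(negPf xy) ?[x == z]eq_sym ?(negPf zx) // orbC.
  - left; apply/eqP/setP => v; rewrite Df !inE WE.
    by case: (eqVneq v y) => [->|_] //=;
       rewrite ?[y == x]eq_sym ?(negPf xy) ?[y == z]eq_sym ?(negPf zy).
  - case/negP: xyF; suff <- : f = [set x; y] by [].
    apply/setP => v; rewrite Df !inE WE.
    by case: (eqVneq v z) => [->|_] /=; rewrite ?(negPf zx) ?(negPf zy) ?orbF.
by apply: (connect_trans (y := z)); apply: connect1;
   rewrite /= DF !inE eqxx ?orbT.
Qed.

Lemma connected_card3 W F : #|W| = 3%N -> F \subset (induced W).2 ->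
  connected (W, F) = (2 <= #|F|)%N.
Proof.
move=> W3 sF; apply/idP/idP; first exact: connected_card3_size.
exact: size_connected_card3.
Qed.

Lemma num_connected_sets3 :
  num_connected_sets G 3 =
    (\sum_(W : {set G} | #|W| == 3) (2 <= #|(induced W).2|))%N.
Proof.
rewrite /num_connected_sets -sum1_card big_mkcond [RHS]big_mkcond /=.
apply: eq_bigr => W _; rewrite inE.
by have [/connected_card3->|] //= := eqVneq #|W| 3%N; case: leqP.
Qed.

(** For [m] at least 2 the connectedness condition is automatic, so the subgraphs with vertex set
    [W] are exactly the choices of [m] edges among those induced by [W]. *)
Lemma num_connected_subgraphs3 m : (2 <= m)%N ->
  num_connected_subgraphs G 3 m =
    (\sum_(W : {set G} | #|W| == 3) 'C(#|(induced W).2|, m))%N.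
Proof.
move=> m2; rewrite /num_connected_subgraphs -sum1_card.
rewrite (eq_bigl (fun H : {set G} * {set {set G}} => (#|H.1| == 3%N) &&
  ((H.2 \subset (induced H.1).2) && (#|H.2| == m)))); last first.
  case=> W F; rewrite inE subgraphE /graph_order /graph_size [fst _]/= [snd _]/=.
  have [W3|] := eqVneq #|W| 3%N; last by rewrite !andbF.
  have [sF|//] := boolP (F \subset _); rewrite connected_card3 //=.
  by case: eqP => [->|]; rewrite ?m2 ?andbF.
(* Sum first over the vertex set, then over the edge sets it admits. *)
rewrite -(pair_big_dep (fun W : {set G} => #|W| == 3%N)
  (fun W F => (F \subset (induced W).2) && (#|F| == m)) (fun _ _ => 1%N)) /=.
apply: eq_bigr => W _; rewrite -cards_draws -sum1_card.
by apply: eq_bigl => F; rewrite inE.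
Qed.

End Subgraphs.

Theorem lemma27 (G : sgraph) :
  (num_connected_sets G 3)%:Z =
    (num_connected_subgraphs G 3 2)%:Z
      - 2%:Z * (num_connected_subgraphs G 3 3)%:Z.
Proof.
(* Without subtraction the identity lives in the naturals and can be checked for each [W]
   separately. *)
suff : (num_connected_sets G 3 + 2 * num_connected_subgraphs G 3 3 =
        num_connected_subgraphs G 3 2)%N by lia.
rewrite num_connected_sets3 !num_connected_subgraphs3 // big_distrr /=.
rewrite -big_split /=; apply: eq_bigr => W /eqP /induced_size_le3.
(* For 0, 1, 2, 3 edges the two sides are 0, 0, 1, 3; the size bound rules out four or more, where
   equality would fail. *)
by case: #|_| => [|[|[|[|]]]].
Qed.
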